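(* Let $\boldsymbol{X}\in\mathbb{R}^{n\times d}$, let $\boldsymbol{W}_Q,\boldsymbol{W}_K,\boldsymbol{W}_V$ be real weight matrices with $d$ rows ($\boldsymbol{W}_Q$ and $\boldsymbol{W}_K$ having the same number of columns), and let $$\boldsymbol{A}=\mathrm{softmax}\left(\frac{\boldsymbol{X}\boldsymbol{W}_Q(\boldsymbol{X}\boldsymbol{W}_K)^{\top}}{\sqrt d}\right)\in\mathbb{R}^{n\times n}$$ be the self-attention matrix. Let $\sigma_a$ be the largest singular value of $\mathcal{HC}[\boldsymbol{A}]$, and let $\mathrm{SA}(\boldsymbol{X})=\boldsymbol{A}\boldsymbol{X}\boldsymbol{W}_V$ be the self-attention output. Then $$\lVert \mathcal{HC}[\mathrm{SA}(\boldsymbol{X})]\rVert_F\le \sigma_a\,\lVert\boldsymbol{W}_V\rVert_2\,\lVert\mathcal{HC}[\boldsymbol{X}]\rVert_F .$$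
   Context: The function $\mathrm{softmax}$ is applied row-wise: for $\boldsymbol{P}\in\mathbb{R}^{n\times n}$, $\mathrm{softmax}(\boldsymbol{P})_{ij}=e^{P_{ij}}/\sum_{k=1}^n e^{P_{ik}}$. For a matrix $\boldsymbol{M}$ with $n$ rows (each column viewed as a signal of length $n$), the direct-current (zero-frequency) component is $\mathcal{DC}[\boldsymbol{M}]=\frac1n\boldsymbol{1}\boldsymbol{1}^{\top}\boldsymbol{M}$ and the high-frequency component is $\mathcal{HC}[\boldsymbol{M}]=\left(\boldsymbol{I}-\frac1n\boldsymbol{1}\boldsymbol{1}^{\top}\right)\boldsymbol{M}$, where $\boldsymbol{1}\in\mathbb{R}^n$ is the all-ones vector and $\boldsymbol{I}$ is the $n\times n$ identity. $\lVert\cdot\rVert_F$ is the Frobenius norm and $\lVert\cdot\rVert_2$ of a matrix is the spectral norm (largest singular value). *)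

(* Defs.v *)
From mathcomp Require Import all_boot all_order all_algebra.
From mathcomp Require Import all_classical all_reals all_analysis.

Set Implicit Arguments.
Unset Strict Implicit.
Unset Printing Implicit Defensive.

Import Order.TTheory GRing.Theory Num.Theory.

Local Open Scope classical_set_scope.
Local Open Scope ring_scope.

Definition softmax (R : realType) (n : nat) (P : 'M[R]_n) : 'M[R]_n :=
  \matrix_(i, j) (expR (P i j) / \sum_(k < n) expR (P i k)).

(* Each column of M is a signal of length n; HC M removes its mean. *)
Definition HC (R : realType) (n m : nat) (M : 'M[R]_(n, m)) : 'M[R]_(n, m) :=
  let ones : 'cV[R]_n := const_mx 1 in
  (1%:M - n%:R^-1 *: (ones *m ones^T)) *m M.

Definition frobenius_norm (R : realType) (m n : nat) (M : 'M[R]_(m, n)) : R :=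
  Num.sqrt (\sum_(i < m) \sum_(j < n) M i j ^+ 2).

(* Square roots of the eigenvalues of M^T M. For m < n this adds 0 to the
   min(m, n) values of the singular value decomposition, which does not affect
   the largest one. *)
Definition singular_values (R : realType) (m n : nat) (M : 'M[R]_(m, n)) :
    set R :=
  [set s | 0 <= s /\ eigenvalue (M^T *m M) (s ^+ 2)].

(* The set of singular values is finite, and nonempty if 0 < n, so its supremum
   is its maximum; if n = 0 it is empty and sup returns 0. *)
Definition largest_singular_value (R : realType) (m n : nat)
    (M : 'M[R]_(m, n)) : R :=
  sup (singular_values M).

Definition spectral_norm (R : realType) (m n : nat) (M : 'M[R]_(m, n)) : R :=
  largest_singular_value M.

Definition attention_matrix (R : realType) (n d k : nat)
    (X : 'M[R]_(n, d)) (WQ WK : 'M[R]_(d, k)) : 'M[R]_n :=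
  softmax ((Num.sqrt d%:R)^-1 *: ((X *m WQ) *m (X *m WK)^T)).

Definition self_attention (R : realType) (n d k m : nat) (X : 'M[R]_(n, d))
    (WQ WK : 'M[R]_(d, k)) (WV : 'M[R]_(d, m)) : 'M[R]_(n, m) :=
  attention_matrix X WQ WK *m X *m WV.

(* Main.v *)
(* Since the rows of A = softmax(P) sum to 1, A maps constant columns to
   constant columns, which HC kills; hence HC(A X W) = HC(A) HC(X) W. It remains
   to bound multiplication by a matrix M in Frobenius norm by the largest
   singular value of M, that is, to show that the maximum of the Rayleigh
   quotient of M^T M is an eigenvalue. *)
Require Import Defs.
From mathcomp Require Import all_boot all_order all_algebra.
From mathcomp Require Import all_classical all_reals all_analysis.
From mathcomp Require Import ring lra.

Import Order.TTheory GRing.Theory Num.Theory.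
Import numFieldNormedType.Exports.
Local Open Scope ring_scope.

(** The squared Frobenius norm, in trace form so that linearity and cyclicity of the trace apply. *)
Definition sqnorm {R : realType} {m n : nat} (M : 'M[R]_(m, n)) : R :=
  \tr (M *m M^T).

Lemma sqnormE {R : realType} {m n : nat} (M : 'M[R]_(m, n)) :
  sqnorm M = \sum_(i < m) \sum_(j < n) M i j ^+ 2.
Proof.
rewrite /sqnorm /mxtrace; apply: eq_bigr => i _.
by rewrite mxE; apply: eq_bigr => j _; rewrite mxE.
Qed.

Lemma frobenius_normE {R : realType} {m n : nat} (M : 'M[R]_(m, n)) :
  frobenius_norm M = Num.sqrt (sqnorm M).
Proof. by rewrite sqnormE. Qed.

Lemma sqnorm_ge0 {R : realType} {m n : nat} (M : 'M[R]_(m, n)) :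
  0 <= sqnorm M.
Proof.
by rewrite sqnormE; do 2![apply: sumr_ge0 => ? _]; exact: sqr_ge0.
Qed.

Lemma sqnorm_eq0 {R : realType} {m n : nat} (M : 'M[R]_(m, n)) :
  (sqnorm M == 0) = (M == 0).
Proof.
apply/eqP/eqP => [|->]; last by rewrite /sqnorm mul0mx mxtrace0.
rewrite sqnormE => /psumr_eq0P M0; apply/matrixP => i j; rewrite mxE.
have Mi0 : \sum_j M i j ^+ 2 = 0.
  by apply: M0 => // k _; apply: sumr_ge0 => l _; exact: sqr_ge0.
apply/eqP; rewrite -sqrf_eq0; apply/eqP.
by move/psumr_eq0P: Mi0; apply=> // l _; exact: sqr_ge0.
Qed.

Lemma sqnorm_tr {R : realType} {m n : nat} (M : 'M[R]_(m, n)) :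
  sqnorm M^T = sqnorm M.
Proof. by rewrite /sqnorm trmxK mxtrace_mulC. Qed.

Lemma sqnormZ {R : realType} {m n : nat} (a : R) (M : 'M[R]_(m, n)) :
  sqnorm (a *: M) = a ^+ 2 * sqnorm M.
Proof. by rewrite /sqnorm linearZ -scalemxAr -scalemxAl !mxtraceZ mulrA. Qed.

Lemma sqnorm_row {R : realType} {m n : nat} (M : 'M[R]_(m, n)) :
  sqnorm M = \sum_(i < m) sqnorm (row i M).
Proof.
rewrite sqnormE; apply: eq_bigr => i _.
by rewrite sqnormE big_ord1; apply: eq_bigr => j _; rewrite mxE.
Qed.

Lemma continuous_quadratic_form {R : realType} {n : nat} (S : 'M[R]_n) :
  continuous (fun x : 'rV[R]_n => \tr (x *m S *m x^T)).
Proof.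
have -> : (fun x : 'rV[R]_n => \tr (x *m S *m x^T)) =
    (fun x => \sum_j (\sum_k x ord0 k * S k j) * x ord0 j).
  apply/funext => x; rewrite /mxtrace big_ord1 mxE.
  by apply: eq_bigr => j _; rewrite !mxE.
have sum_continuous (T : topologicalType) (F : 'I_n -> T -> R) :
    (forall i, continuous (F i)) -> continuous (fun x => \sum_i F i x).
  move=> cF; apply: (@continuous_big R^o _ +%R 0 xpredT) => // z.
  exact: add_continuous.
apply: (sum_continuous _ _) => j x.
apply: (@continuousM _ _ (fun y : 'rV[R]_n => \sum_k y ord0 k * S k j)
          (fun y : 'rV[R]_n => y ord0 j)); last exact: coord_continuous.
apply: (sum_continuous _ _) => k {}x.
apply: (@continuousM _ _ (fun y : 'rV[R]_n => y ord0 k) (fun=> S k j)).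
  exact: coord_continuous.
exact: cst_continuous.
Qed.

(** Moving from [c] by [- t *: (c *m T)] changes the form by [- 2 t |c T|^2 + O(t^2)], which would
    make it negative for small [t > 0] if [c *m T] were nonzero. *)
Lemma psd_kernel {R : realType} {n : nat} (T : 'M[R]_n) (c : 'rV[R]_n) :
  T^T = T -> (forall x : 'rV[R]_n, 0 <= \tr (x *m T *m x^T)) ->
  \tr (c *m T *m c^T) = 0 -> c *m T = 0.
Proof.
move=> symT psdT c0; set y := c *m T; set Q := \tr (y *m T *m y^T).
have expand t : \tr ((c - t *: y) *m T *m (c - t *: y)^T) =
    t ^+ 2 * Q - t *+ 2 * sqnorm y.
  have cross : \tr (y *m T *m c^T) = sqnorm y.
    by rewrite /sqnorm -mulmxA -{1}symT -trmx_mul.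
  rewrite [(c - _)^T]linearB /= [(t *: y)^T]linearZ /= !mulmxBl !mulmxBr.
  rewrite -!scalemxAr -!scalemxAl !linearB /= !mxtraceZ.
  rewrite c0 cross -/y -/(sqnorm y) -/Q.
  ring.
have Q0 : 0 <= Q by exact: psdT.
have := sqnorm_ge0 y; rewrite le_eqVlt => /orP[|N0].
  by rewrite eq_sym sqnorm_eq0 => /eqP.
have Q1 : 0 < Q + 1 by rewrite ltr_wpDl.
(* The minimiser would be [sqnorm y / Q]; adding 1 covers [Q = 0] and still gives the negative value
   [- t^2 (Q + 2)]. *)
pose t := sqnorm y / (Q + 1).
have yt : sqnorm y = t * (Q + 1) by rewrite divfK // gt_eqF.
have t0 : 0 < t by rewrite divr_gt0.
have := psdT (c - t *: y); rewrite expand yt.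
have -> : t ^+ 2 * Q - t *+ 2 * (t * (Q + 1)) = - (t ^+ 2 * (Q + 2)) by ring.
by rewrite oppr_ge0 leNgt mulr_gt0 ?exprn_gt0 // ltr_wpDl.
Qed.

Lemma unit_sphere_compact {R : realType} {n : nat} :
  compact [set x : 'rV[R]_n | sqnorm x = 1].
Proof.
have box : compact [set x : 'rV[R]_n | forall i, `[-1, 1]%classic (x ord0 i)].
  apply: (@rV_compact R n (fun=> `[-1, 1]%classic)) => i.
  exact: segment_compact.
apply: subclosed_compact box _.
  have cont : continuous (@sqnorm R 1 n).
    (* On row vectors [sqnorm] is the quadratic form of the identity, so the sphere is closed in the
       cube. *)
    have -> : @sqnorm R 1 n = fun x => \tr (x *m 1%:M *m x^T).
      by apply/funext => x; rewrite mulmx1.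
    exact: continuous_quadratic_form.
  by move/continuous_closedP : cont => /(_ _ (@closed_eq R 1)).
move=> x /= x1 i; rewrite in_itv /= -ler_norml -(@expr_le1 _ 2) ?normr_ge0 //.
rewrite -normrX ger0_norm ?sqr_ge0 // -x1 sqnormE big_ord1 (bigD1 i) //= lerDl.
by apply: sumr_ge0 => k _; exact: sqr_ge0.
Qed.

(* The maximum [mu] of the Rayleigh quotient is attained at some [c], so
   [mu - S] is positive semidefinite and degenerate at [c]. *)
Lemma symmetric_max_eigenvalue {R : realType} {n : nat} (S : 'M[R]_n.+1) :
  S^T = S -> exists2 mu, eigenvalue S mu &
    forall x : 'rV[R]_n.+1, \tr (x *m S *m x^T) <= mu * sqnorm x.
Proof.
move=> symS.
have scale a (x : 'rV_n.+1) :
    \tr ((a *: x) *m S *m (a *: x)^T) = a ^+ 2 * \tr (x *m S *m x^T).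
  by rewrite linearZ -scalemxAr -!scalemxAl !mxtraceZ mulrA.
have [|c /set_mem c1 maxc] := EVT_max_rV _ (@unit_sphere_compact R n.+1)
    (continuous_subspaceT (@continuous_quadratic_form R _ S)).
  (* The sphere is nonempty because the dimension is [n.+1]. *)
  exists (delta_mx ord0 ord0); rewrite /= /sqnorm trmx_delta mul_delta_mx.
  by rewrite /mxtrace big_ord1 mxE.
set mu := \tr (c *m S *m c^T) in maxc.
have bound (x : 'rV_n.+1) : \tr (x *m S *m x^T) <= mu * sqnorm x.
  have [->|x0] := eqVneq x 0.
    by rewrite /sqnorm !mul0mx mxtrace0 mulr0.
  have N0 : 0 < sqnorm x by rewrite lt_def sqnorm_eq0 x0 sqnorm_ge0.
  have sq : (Num.sqrt (sqnorm x))^-1 ^+ 2 = (sqnorm x)^-1.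
    by rewrite exprVn sqr_sqrtr // ltW.
  (* Homogeneity of degree 2 carries the bound from the sphere to every [x != 0]. *)
  have := maxc ((Num.sqrt (sqnorm x))^-1 *: x).
  rewrite scale sq mulrC ler_pdivrMr //; apply; apply/mem_set => /=.
  by rewrite sqnormZ sq mulVf // gt_eqF.
exists mu => //; apply/eigenvalueP; exists c; last first.
  by rewrite -sqnorm_eq0 c1 oner_eq0.
have quad (x : 'rV_n.+1) : \tr (x *m (mu%:M - S) *m x^T) =
    mu * sqnorm x - \tr (x *m S *m x^T).
  by rewrite mulmxBr mulmxBl linearB /= mul_mx_scalar -scalemxAl mxtraceZ.
suff /eqP : c *m (mu%:M - S) = 0.
  by rewrite mulmxBr mul_mx_scalar subr_eq0 => /eqP.
apply: psd_kernel => [|x|].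
- by rewrite linearB /= tr_scalar_mx symS.
- by rewrite quad subr_ge0.
- by rewrite quad c1 mulr1 subrr.
Qed.

(** Either some singular value lies below the supremum, or [sup] takes its default value 0. *)
Lemma largest_singular_value_ge0 {R : realType} {m n : nat}
    (M : 'M[R]_(m, n)) : 0 <= largest_singular_value M.
Proof.
rewrite /largest_singular_value.
have [[[s Ms] bdM]|/sup_out ->//] := pselect (has_sup (singular_values M)).
by apply: le_trans (ub_le_sup bdM Ms); case: Ms.
Qed.

(** The Rayleigh bound for [M^T *m M] applies to each column of [Y], and the square root of its top
    eigenvalue [mu] is a singular value of [M]. *)
Lemma sqnorm_mulmx_le {R : realType} {m n p : nat} (M : 'M[R]_(m, n))
    (Y : 'M[R]_(n, p)) :
  sqnorm (M *m Y) <= largest_singular_value M ^+ 2 * sqnorm Y.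
Proof.
case: n => [|n] in M Y *.
  by rewrite [Y]flatmx0 mulmx0 /sqnorm !mul0mx !mxtrace0 mulr0.
have [|mu eig_mu bound] := @symmetric_max_eigenvalue R n (M^T *m M).
  by rewrite trmx_mul trmxK.
have rayleigh (v : 'rV_n.+1) : \tr (v *m (M^T *m M) *m v^T) = sqnorm (v *m M^T).
  by rewrite /sqnorm trmx_mul trmxK !mulmxA.
have eigenvector_bound a (v : 'rV_n.+1) : v *m (M^T *m M) = a *: v ->
    a * sqnorm v = sqnorm (v *m M^T).
  by move=> va; rewrite -rayleigh va -scalemxAl mxtraceZ.
have v_gt0 (v : 'rV[R]_n.+1) : v != 0 -> 0 < sqnorm v.
  by rewrite lt_def sqnorm_eq0 sqnorm_ge0 => ->.
have mu_ge0 : 0 <= mu.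
  have /eigenvalueP[v va v0] := eig_mu.
  by rewrite -(pmulr_lge0 _ (v_gt0 _ v0)) (eigenvector_bound _ _ va) sqnorm_ge0.
have mu_le : mu <= largest_singular_value M ^+ 2.
  rewrite -[mu]sqr_sqrtr // ler_sqr ?nnegrE ?sqrtr_ge0 //; last first.
    exact: largest_singular_value_ge0.
  apply: ub_le_sup; last by split; rewrite ?sqrtr_ge0 ?sqr_sqrtr.
  (* [sup] dominates its set only if the set is bounded: the Rayleigh bound at an eigenvector for
     [s ^+ 2] gives [s ^+ 2 <= mu]. *)
  exists (Num.sqrt mu) => s [s0 /eigenvalueP[v va v0]].
  rewrite -(ger0_norm s0) -sqrtr_sqr ler_sqrt //.
  rewrite -(ler_pM2r (v_gt0 _ v0)) (eigenvector_bound _ _ va) -rayleigh.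
  exact: bound.
(* Transposing turns the columns of [Y] into row vectors, on which the Rayleigh bound is stated. *)
rewrite -sqnorm_tr trmx_mul -(sqnorm_tr Y) !(sqnorm_row _^T) sqnorm_row.
rewrite mulr_sumr; apply: ler_sum => i _.
rewrite row_mul -rayleigh; apply: le_trans (bound _) _.
by rewrite ler_wpM2r ?sqnorm_ge0.
Qed.

(* With [s] the largest singular value and [Z = Y M], expand
   [0 <= |s^2 Y - Z M^T|^2] and bound [|Z M^T|] through [sqnorm_mulmx_le]. *)
Lemma sqnorm_mulmx_ler {R : realType} {m n p : nat} (M : 'M[R]_(m, n))
    (Y : 'M[R]_(p, m)) :
  sqnorm (Y *m M) <= largest_singular_value M ^+ 2 * sqnorm Y.
Proof.
set s := largest_singular_value M; set Z := Y *m M.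
have ZM : sqnorm (Z *m M^T) <= s ^+ 2 * sqnorm Z.
  by rewrite -sqnorm_tr trmx_mul trmxK -(sqnorm_tr Z); exact: sqnorm_mulmx_le.
have cross : \tr (Z *m M^T *m Y^T) = sqnorm Z.
  by rewrite -mulmxA -trmx_mul.
(* The expansion ends with a division by [s ^+ 2]; for [s = 0], [ZM] forces [Z *m M^T = 0], and
   [cross] then gives [sqnorm Z = 0]. *)
have [s0|s0] := eqVneq s 0.
  move: ZM; rewrite s0 expr0n !mul0r => ZM.
  have /eqP : sqnorm (Z *m M^T) = 0 by apply/eqP; rewrite eq_le ZM sqnorm_ge0.
  by rewrite sqnorm_eq0 -cross => /eqP ->; rewrite mul0mx mxtrace0.
have := sqnorm_ge0 (s ^+ 2 *: Y - Z *m M^T).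
have -> : sqnorm (s ^+ 2 *: Y - Z *m M^T) =
    s ^+ 4 * sqnorm Y - s ^+ 2 * sqnorm Z *+ 2 + sqnorm (Z *m M^T).
  have cross' : \tr (Y *m (Z *m M^T)^T) = sqnorm Z.
    by rewrite -mxtrace_tr trmx_mul trmxK cross.
  rewrite /sqnorm [(s ^+ 2 *: Y - _)^T]linearB /= [(_ *: Y)^T]linearZ /=.
  rewrite mulmxBl !mulmxBr -!scalemxAr -!scalemxAl !linearB /= !mxtraceZ.
  by rewrite cross cross'; ring.
have s2 : 0 < s ^+ 2 by rewrite lt_def sqrf_eq0 s0 sqr_ge0.
move=> expansion; rewrite -(ler_pM2l s2); nra.
Qed.

Lemma frobenius_norm_mulmx_le {R : realType} {m n p q : nat}
    (B : 'M[R]_(m, n)) (Y : 'M[R]_(n, p)) (W : 'M[R]_(p, q)) :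
  frobenius_norm (B *m Y *m W) <=
    largest_singular_value B * spectral_norm W * frobenius_norm Y.
Proof.
have b0 := largest_singular_value_ge0 B.
have w0 := largest_singular_value_ge0 W.
rewrite !frobenius_normE -[leLHS]ger0_norm ?sqrtr_ge0 //.
rewrite -[leRHS]ger0_norm ?mulr_ge0 ?sqrtr_ge0 //.
rewrite -ler_sqr ?nnegrE // !real_normK ?num_real // exprMn.
rewrite !sqr_sqrtr ?sqnorm_ge0 //; apply: le_trans (sqnorm_mulmx_ler _ _) _.
rewrite exprMn mulrAC mulrC ler_wpM2r ?sqr_ge0 //.
exact: sqnorm_mulmx_le.
Qed.

Lemma softmax_const {R : realType} {n p : nat} (P : 'M[R]_n) (a : R) :
  softmax P *m const_mx a = const_mx a :> 'M[R]_(n, p).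
Proof.
apply/matrixP => i j; rewrite !mxE.
under eq_bigr do rewrite !mxE.
rewrite -mulr_suml -mulr_suml divff ?mul1r // gt_eqF //.
(* [P] is square, so the row index [i] is also a column index and the softmax denominator has at
   least one positive term. *)
rewrite (bigD1 i) //= ltr_wpDr ?expR_gt0 //.
by apply: sumr_ge0 => k _; exact: expR_ge0.
Qed.

Lemma HC_const {R : realType} {n p : nat} (a : R) :
  HC (const_mx a : 'M[R]_(n, p)) = 0.
Proof.
apply/matrixP => i j; rewrite /HC mulmxBl mul1mx -scalemxAl -mulmxA !mxE.
rewrite big_ord1 !mxE mul1r.
under eq_bigr do rewrite !mxE mul1r.
rewrite sumr_const card_ord -[a *+ n]mulr_natl mulKf ?subrr //.
(* The row index [i] witnesses [0 < n], so [n%:R] is invertible. *)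
by rewrite pnatr_eq0 -lt0n (leq_ltn_trans _ (ltn_ord i)).
Qed.

Lemma HC_mulmx {R : realType} {n m p : nat} (M : 'M[R]_(n, m))
    (N : 'M[R]_(m, p)) :
  HC (M *m N) = HC M *m N.
Proof. by rewrite /HC mulmxA. Qed.

(* Row sums 1 make [softmax P] fix [X - HC X], whose columns are constant. *)
Lemma HC_softmax {R : realType} {n p : nat} (P : 'M[R]_n) (X : 'M[R]_(n, p)) :
  HC (softmax P *m X) = HC (softmax P) *m HC X.
Proof.
rewrite {3}/HC mulmxA mulmxBr mulmx1 mulmxBl -HC_mulmx -scalemxAr mulmxA.
by rewrite -HC_mulmx softmax_const HC_const mul0mx scaler0 mul0mx subr0.
Qed.

Theorem theorem2 (R : realType) (n d k m : nat) (X : 'M[R]_(n, d))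
    (WQ WK : 'M[R]_(d, k)) (WV : 'M[R]_(d, m)) :
  let A := attention_matrix X WQ WK in
  let sigma_a := largest_singular_value (HC A) in
  frobenius_norm (HC (self_attention X WQ WK WV))
    <= sigma_a * spectral_norm WV * frobenius_norm (HC X).
Proof.
cbv zeta; rewrite HC_mulmx HC_softmax.
exact: frobenius_norm_mulmx_le.
Qed.
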